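(* Let $\mathcal{A}$ be an Artin group with standard Artin generating set $S$. Then $\operatorname{Env}(\mathcal{D}(S^{\mathcal{A}}))\cong\mathcal{A}$.
   Context: An Artin group $\mathcal{A}$ is a group with a presentation with generators $S=\{s_1,\dots,s_n\}$ and relations $(s_is_j)_{m_{ij}}=(s_js_i)_{m_{ij}}$ for $i\ne j$, where $m_{ij}=m_{ji}\in\{2,3,4,\dots\}\cup\{\infty\}$; here $(s_is_j)_{m}$ denotes the alternating word $s_is_js_is_j\cdots$ of length $m$, and there is no relation for $s_i,s_j$ if $m_{ij}=\infty$. A quandle is a non-empty set $Q$ with a binary operation $*$ such that: (i) $x*x=x$ for all $x$; (ii) for all $x,y\in Q$ there is a unique $z\in Q$ with $x=z*y$; (iii) $(x*y)*z=(x*z)*(y*z)$ for all $x,y,z$. For a group $G$ and a non-empty subset $A\subseteq G$, let $A^G$ be the set of all conjugates in $G$ of elements of $A$. The Dehn quandle $\mathcal{D}(A^G)$ is the set $A^G$ with the operation $x*y=yxy^{-1}$. The enveloping group $\operatorname{Env}(Q)$ of a quandle $Q$ is the group with generators $\{e_x\mid x\in Q\}$ and defining relations $e_{x*y}=e_ye_xe_y^{-1}$ for all $x,y\in Q$. *)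

(* Defs.v *)
From HB Require Import structures.
From mathcomp Require Import all_boot.
From mathcomp Require Import boolp classical_sets.

Set Implicit Arguments.
Unset Strict Implicit.
Unset Printing Implicit Defensive.

Local Open Scope group_scope.
Local Open Scope quotient_scope.
Local Open Scope classical_set_scope.

Definition isomorphic (G H : groupType) : Prop :=
  exists f : {multiplicative G -> H}, bijective f.

(* The letter (x, true) stands for x and (x, false) for its formal inverse. *)
Definition word (X : Type) : Type := seq (X * bool).

Definition inv_word (X : Type) (w : word X) : word X :=
  rev [seq (l.1, ~~ l.2) | l <- w].

(* [R u v] is the defining relation u = v; [pres_eq R] is the least congruence
   on words containing R and the free cancellations. *)
Inductive pres_eq (X : Type) (R : word X -> word X -> Prop) :
    word X -> word X -> Prop :=
| pres_rel u v : R u v -> pres_eq R u v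
| pres_cancel x b : pres_eq R [:: (x, b); (x, ~~ b)] [::]
| pres_cat u u' v v' :
    pres_eq R u u' -> pres_eq R v v' -> pres_eq R (u ++ v) (u' ++ v')
| pres_refl u : pres_eq R u u
| pres_sym u v : pres_eq R u v -> pres_eq R v u
| pres_trans v u w : pres_eq R u v -> pres_eq R v w -> pres_eq R u w.

Section PresentedGroup.
Variables (X : Type) (R : word X -> word X -> Prop).

Definition pres_eqb : rel {classic word X} := fun u v => `[< pres_eq R u v >].

Fact pres_eqb_refl : reflexive pres_eqb.
Proof. by move=> u; apply/asboolP; exact: pres_refl. Qed.

Fact pres_eqb_sym : symmetric pres_eqb.
Proof.
by move=> u v; apply/asboolP/asboolP => h; exact: pres_sym.
Qed.

Fact pres_eqb_trans : transitive pres_eqb.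
Proof.
by move=> v u w /asboolP uv /asboolP vw; apply/asboolP; exact: pres_trans vw.
Qed.

Canonical pres_equiv := EquivRel pres_eqb pres_eqb_refl pres_eqb_sym pres_eqb_trans.

Definition presented : Type := {eq_quot pres_equiv}.
HB.instance Definition _ := Choice.copy presented {eq_quot pres_equiv}.

Definition pres_class (w : word X) : presented := \pi_({eq_quot pres_equiv}) w.
Definition pres_repr (a : presented) : word X :=
  repr (a : {eq_quot pres_equiv}).

Lemma pres_reprK (a : presented) : pres_class (pres_repr a) = a.
Proof. exact: reprK. Qed.

Lemma pres_classP (u v : word X) : pres_class u = pres_class v <-> pres_eq R u v.
Proof.
split; first by move/eqmodP/asboolP.
by move=> h; apply/eqmodP/asboolP.
Qed.

Definition pres_one : presented := pres_class [::].
Definition pres_mul (a b : presented) : presented :=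
  pres_class (pres_repr a ++ pres_repr b).
Definition pres_inv (a : presented) : presented :=
  pres_class (inv_word (pres_repr a)).

Lemma pres_class_cat (u v : word X) :
  pres_class (u ++ v) = pres_mul (pres_class u) (pres_class v).
Proof.
by apply/pres_classP; apply: pres_cat; apply/pres_classP; rewrite pres_reprK.
Qed.

Lemma pres_eq_mulV (w : word X) : pres_eq R (w ++ inv_word w) [::].
Proof.
elim: w => [|[x b] w IH]; first exact: pres_refl.
rewrite /inv_word map_cons rev_cons -cats1 -/(inv_word w).
have -> : ((x, b) :: w) ++ inv_word w ++ [:: (x, ~~ b)] =
          [:: (x, b)] ++ ((w ++ inv_word w) ++ [:: (x, ~~ b)]) by rewrite -!catA.
apply: (@pres_trans _ _ ([:: (x, b)] ++ ([::] ++ [:: (x, ~~ b)]))).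
  by do 2?[apply: pres_cat => //; try exact: pres_refl].
exact: pres_cancel.
Qed.

Lemma inv_wordK : involutive (@inv_word X).
Proof.
move=> w; rewrite /inv_word map_rev revK -map_comp -[RHS]map_id.
by apply: eq_map => -[x b] /=; rewrite negbK.
Qed.

Fact pres_mulA : associative pres_mul.
Proof.
move=> a b c; rewrite -(pres_reprK a) -(pres_reprK b) -(pres_reprK c).
by rewrite -!pres_class_cat catA.
Qed.

Fact pres_mul1 : left_id pres_one pres_mul.
Proof. by move=> a; rewrite -(pres_reprK a) -pres_class_cat. Qed.

Fact pres_mulr1 : right_id pres_one pres_mul.
Proof. by move=> a; rewrite -(pres_reprK a) -pres_class_cat cats0. Qed.

Fact pres_mulV : right_inverse pres_one pres_inv pres_mul.
Proof.
move=> a; rewrite -{1}(pres_reprK a) -pres_class_cat.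
by apply/pres_classP; exact: pres_eq_mulV.
Qed.

Fact pres_mulVl : left_inverse pres_one pres_inv pres_mul.
Proof.
move=> a; rewrite -{2}(pres_reprK a) -pres_class_cat.
apply/pres_classP; rewrite -{2}(inv_wordK (pres_repr a)).
exact: pres_eq_mulV.
Qed.

HB.instance Definition _ := isGroup.Build presented
  pres_mulA pres_mul1 pres_mulr1 pres_mulVl pres_mulV.

Definition pres_gen (x : X) : presented := pres_class [:: (x, true)].

End PresentedGroup.

(* [None] encodes the label infinity; diagonal entries are irrelevant. *)
Record artin_matrix (n : nat) := ArtinMatrix {
  artin_label :> 'I_n -> 'I_n -> option nat;
  artin_label_sym : forall i j, artin_label i j = artin_label j i;
  artin_label_ge2 : forall i j k,
    i != j -> artin_label i j = Some k -> (2 <= k)%N }.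

(* (x y)_m = x y x y ... with m letters *)
Definition alt_word (X : Type) (x y : X) (m : nat) : word X :=
  mkseq (fun k => (if odd k then y else x, true)) m.

Inductive artin_rel (n : nat) (M : artin_matrix n) :
    word 'I_n -> word 'I_n -> Prop :=
| ArtinRel i j m : i != j -> M i j = Some m ->
    artin_rel M (alt_word i j m) (alt_word j i m).

Definition artin_group (n : nat) (M : artin_matrix n) : groupType :=
  presented (artin_rel M).

Definition artin_gen (n : nat) (M : artin_matrix n) (i : 'I_n) : artin_group M :=
  pres_gen (artin_rel M) i.

Definition standard_artin_generating_set (A : groupType) (S : set A) : Prop :=
  exists (n : nat) (M : artin_matrix n) (f : {multiplicative artin_group M -> A}),
    bijective f /\ S = range (fun i : 'I_n => f (artin_gen M i)).

HB.mixin Record isQuandle Q := {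
  qop : Q -> Q -> Q;
  quandle_inhabited : inhabited Q;
  qop_idem : forall x, qop x x = x;
  qop_uniq : forall x y, exists! z, x = qop z y;
  qop_dist : forall x y z, qop (qop x y) z = qop (qop x z) (qop y z) }.

#[short(type="quandleType")]
HB.structure Definition Quandle := { Q of isQuandle Q }.

Definition conjugates (G : groupType) (A : set G) : set G :=
  [set x | exists2 a, A a & exists g : G, x = g * a * g^-1].

(* The non-emptiness proof is kept as a parameter since quandles are
   non-empty. *)
Definition dehn_quandle (G : groupType) (A : set G) (A0 : A !=set0) : Type :=
  set_type (conjugates A).

Section DehnQuandle.
Variables (G : groupType) (A : set G) (A0 : A !=set0).
Local Notation D := (dehn_quandle A0).

Definition dehn_val (x : D) : G := \val (x : set_type (conjugates A)).

Lemma dehn_valP (x : D) : conjugates A (dehn_val x).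
Proof. exact: set_mem (valP x). Qed.

Definition mk_dehn (x : G) (hx : conjugates A x) : D :=
  exist _ x (mem_set hx).

Lemma mk_dehnK (x : G) (hx : conjugates A x) : dehn_val (mk_dehn hx) = x.
Proof. by []. Qed.

Lemma dehn_val_inj : injective dehn_val.
Proof. exact: val_inj. Qed.

Lemma conjugatesJ (x y : G) : conjugates A x -> conjugates A (y * x * y^-1).
Proof.
by case=> a Aa [g ->]; exists a => //; exists (y * g); rewrite invgM !mulgA.
Qed.

Definition dehn_op (x y : D) : D :=
  mk_dehn (conjugatesJ (dehn_val y) (dehn_valP x)).

Lemma dehn_opE (x y : D) :
  dehn_val (dehn_op x y) = dehn_val y * dehn_val x * (dehn_val y)^-1.
Proof. by []. Qed.

Fact dehn_inhabited : inhabited D.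
Proof.
case: A0 => a Aa; suff h : conjugates A a by exact: (inhabits (mk_dehn h)).
by exists a => //; exists 1; rewrite mul1g invg1 mulg1.
Qed.

Fact dehn_idem x : dehn_op x x = x.
Proof. by apply: dehn_val_inj; rewrite dehn_opE mulgK. Qed.

Fact dehn_uniq x y : exists! z, x = dehn_op z y.
Proof.
exists (mk_dehn (conjugatesJ (dehn_val y)^-1 (dehn_valP x))); split.
  by apply: dehn_val_inj; rewrite dehn_opE mk_dehnK invgK !mulgA mulgV mul1g mulgK.
move=> z ->; apply: dehn_val_inj.
by rewrite mk_dehnK dehn_opE invgK !mulgA mulVg mul1g mulgVK.
Qed.

Fact dehn_dist x y z :
  dehn_op (dehn_op x y) z = dehn_op (dehn_op x z) (dehn_op y z).
Proof.
by apply: dehn_val_inj; rewrite !dehn_opE !invgM !invgK !mulgA !mulgVK.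
Qed.

HB.instance Definition _ := isQuandle.Build D
  dehn_inhabited dehn_idem dehn_uniq dehn_dist.

End DehnQuandle.

Inductive env_rel (Q : quandleType) : word Q -> word Q -> Prop :=
| EnvRel (x y : Q) :
    env_rel [:: (qop x y, true)] [:: (y, true); (x, true); (y, false)].

Definition Env (Q : quandleType) : groupType := presented (@env_rel Q).

(* Main.v *)
Require Import Defs.
From HB Require Import structures.
From mathcomp Require Import all_boot.
From mathcomp Require Import boolp classical_sets.

(** Sending [e_x] to [x] defines a morphism [pi] from the enveloping group of
    a Dehn quandle to the ambient group, and conjugation by any [a] in the
    enveloping group permutes the generators the way conjugation by [pi a]
    permutes the elements of the quandle ([env_conj]): one induction on a word
    for [a], each letter being an instance of a defining relation.

    This makes every relation of conjugacy form between quandle elements lift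
    to the enveloping group, and Artin relations have this form: if [u] is the
    alternating word [(s t)_(m-1)] and [c] is the letter that extends it to
    [(s t)_m], then [(s t)_m = u c] and [(t s)_m = t u], so the relation says
    [u c u^-1 = t].  Hence [s_i |-> e_(s_i)] extends to a morphism [phi] from
    the Artin group to the enveloping group, and [pi \o phi] is the given
    identification.  The morphism [phi] is onto, since [x = g s_i g^-1] gives
    [e_x = phi(g) e_(s_i) phi(g)^-1] by [env_conj] again.  So [pi] is
    bijective. *)

Set Implicit Arguments.
Unset Strict Implicit.
Unset Printing Implicit Defensive.

Local Open Scope group_scope.
Local Open Scope classical_set_scope.

Section MultiplicativeGroup.
Variables (G H : groupType) (h : {multiplicative G -> H}).

Lemma multiplicative1 : h 1 = 1.
Proof. by apply: (mulgI (h 1)); rewrite -gmulfM !mulg1. Qed.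

Lemma multiplicativeV x : h x^-1 = (h x)^-1.
Proof. by apply: (mulgI (h x)); rewrite -gmulfM !mulgV multiplicative1. Qed.

End MultiplicativeGroup.

Section Eval.
Variables (X : Type) (G : groupType).

Definition eval_letter (f : X -> G) (l : X * bool) : G :=
  if l.2 then f l.1 else (f l.1)^-1.

Definition eval_word (f : X -> G) (w : word X) : G :=
  foldr (fun l g => eval_letter f l * g) 1 w.

Lemma eval_word_cat f u v :
  eval_word f (u ++ v) = eval_word f u * eval_word f v.
Proof. by elim: u => [|l u IH] /=; rewrite ?mul1g // IH mulgA. Qed.

Lemma eval_word1 f x : eval_word f [:: (x, true)] = f x.
Proof. exact: mulg1. Qed.

End Eval.

Lemma eval_word_morph (X : Type) (G H : groupType) (h : {multiplicative G -> H})
    (f : X -> G) w :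
  h (eval_word f w) = eval_word (h \o f) w.
Proof.
elim: w => [|[x b] w IH] /=; first exact: multiplicative1.
by rewrite gmulfM IH; case: b; rewrite /eval_letter //= multiplicativeV.
Qed.

Section Lift.
Variables (X : Type) (R : word X -> word X -> Prop).

Lemma pres_classE w : pres_class R w = eval_word (pres_gen R) w.
Proof.
elim: w => [//|[x b] w IH].
rewrite -cat1s pres_class_cat IH; congr (_ * _).
case: b => //; apply: (mulgI (pres_gen R x)); rewrite mulgV.
by rewrite -[LHS]pres_class_cat; apply/pres_classP; exact: pres_cancel.
Qed.

Variables (G : groupType) (f : X -> G).
Hypothesis fR : forall u v, R u v -> eval_word f u = eval_word f v.

Lemma eval_pres_eq u v : pres_eq R u v -> eval_word f u = eval_word f v.
Proof.
elim=> {u v} [u v /fR //|x b|u u' v v' _ IHu _ IHv|//|u v _ -> //|].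
- by case: b; rewrite /= /eval_letter /= mulg1 ?mulgV ?mulVg.
- by rewrite !eval_word_cat IHu IHv.
- by move=> v u w _ -> _ ->.
Qed.

Definition pres_lift_fun (a : presented R) : G := eval_word f (pres_repr a).

Lemma pres_lift_class w : pres_lift_fun (pres_class R w) = eval_word f w.
Proof.
by apply: eval_pres_eq; apply/pres_classP; rewrite pres_reprK.
Qed.

Lemma pres_lift_morph (a b : presented R) :
  pres_lift_fun (a * b) = pres_lift_fun a * pres_lift_fun b.
Proof.
rewrite -(pres_reprK a) -(pres_reprK b) -[X in pres_lift_fun X]pres_class_cat.
by rewrite !pres_lift_class eval_word_cat.
Qed.

Lemma pres_lift : exists h : {multiplicative presented R -> G},
  forall x, h (pres_gen R x) = f x.
Proof.
pose hM := isMultiplicative.Build _ _ pres_lift_fun pres_lift_morph.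
pose h : {multiplicative presented R -> G} := HB.pack pres_lift_fun hM.
by exists h => x; rewrite [LHS]pres_lift_class eval_word1.
Qed.

End Lift.

Lemma morph_class (X : Type) (R : word X -> word X -> Prop) (G : groupType)
    (h : {multiplicative presented R -> G}) (w : word X) :
  h (pres_class R w) = eval_word (h \o pres_gen R) w.
Proof. by rewrite pres_classE eval_word_morph. Qed.

Lemma pres_surj (X : Type) (R : word X -> word X -> Prop) (G : groupType)
    (h : {multiplicative G -> presented R}) :
  (forall x, exists g, h g = pres_gen R x) -> forall a, exists g, h g = a.
Proof.
move=> hgen a; rewrite -(pres_reprK a) pres_classE.
elim: (pres_repr a) => [|[x b] w [g IH]] /=.
  by exists 1; exact: multiplicative1.
have [k kx] := hgen x.
exists ((if b then k else k^-1) * g); rewrite gmulfM IH /eval_letter /= -kx.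
by case: b => //; rewrite multiplicativeV.
Qed.

Section EnvDehn.
Variables (G : groupType) (C : set G) (C0 : C !=set0).
Local Notation D := (dehn_quandle C0).
Local Notation e := (pres_gen (@env_rel D)).

Lemma env_gen_op (x y : D) : e (dehn_op x y) = e y * e x * (e y)^-1.
Proof.
have /pres_classP := pres_rel (EnvRel x y).
by rewrite !pres_classE /= /eval_letter /= !mulg1 mulgA.
Qed.

Lemma env_to_group :
  exists h : {multiplicative Env D -> G}, forall x, h (e x) = dehn_val x.
Proof.
apply: (@pres_lift _ (@env_rel D) _ (@dehn_val _ _ C0)) => _ _ [x y].
by rewrite /= /eval_letter /= !mulg1 mulgA.
Qed.

(** Only [pi a] enters the hypothesis, so a conjugacy relation in [G] lifts
    whatever preimage of the conjugating element is chosen; in particular the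
    kernel of [pi] is central. *)
Lemma env_conj (pi : {multiplicative Env D -> G}) :
  (forall x, pi (e x) = dehn_val x) ->
  forall (a : Env D) (x y : D),
  dehn_val y = pi a * dehn_val x * (pi a)^-1 -> e y = a * e x * a^-1.
Proof.
move=> pie a x; rewrite -(pres_reprK a) pres_classE.
elim: (pres_repr a) => [|[z b] w IH] y /=.
  by rewrite multiplicative1 !(mul1g, invg1, mulg1) => /dehn_val_inj ->.
set v := eval_word _ w in IH *.
pose y' : D := mk_dehn C0 (conjugatesJ (pi v) (dehn_valP x)).
have ey' : e y' = v * e x * v^-1 by exact: IH.
rewrite gmulfM; case: b; rewrite /eval_letter /= ?multiplicativeV pie => yE.
  have -> : y = dehn_op y' z.
    by apply: dehn_val_inj; rewrite yE dehn_opE mk_dehnK invgM !mulgA.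
  by rewrite env_gen_op ey' invgM !mulgA.
(* For an inverse letter the defining relation is read from [y] to [y']. *)
have y'E : y' = dehn_op y z.
  apply: dehn_val_inj; rewrite dehn_opE yE mk_dehnK invgM invgK !mulgA.
  by rewrite mulgV mul1g mulgK.
move: ey'; rewrite y'E env_gen_op => eyE.
apply: (mulgI (e z)); apply: (mulIg (e z)^-1); rewrite eyE invgM invgK !mulgA.
by rewrite mulgV mul1g mulgK.
Qed.

End EnvDehn.

(** Peeling the last letter off [(x y)_(m+1)] and the first one off
    [(y x)_(m+1)] leaves [(x y)_m] both times, which exhibits the Artin
    relation as a conjugacy. *)
Lemma alt_wordSr (X : Type) (x y : X) m :
  alt_word x y m.+1 = alt_word x y m ++ [:: (if odd m then y else x, true)].
Proof. by rewrite /alt_word mkseqS cats1. Qed.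

Lemma alt_wordSl (X : Type) (x y : X) m :
  alt_word x y m.+1 = (x, true) :: alt_word y x m.
Proof.
rewrite /alt_word /mkseq /= -[1%N]/(1 + 0)%N iotaDl -map_comp.
by congr cons; apply: eq_map => k /=; case: (odd k).
Qed.

Theorem corollary3p15 (A : groupType) (S : set A) (S0 : S !=set0)
    (hS : standard_artin_generating_set S) :
  isomorphic (Env (dehn_quandle S0)) A.
Proof.
have [n [M [f [[k fK kK] SE]]]] := hS.
set D := dehn_quandle S0; pose e := pres_gen (@env_rel D).
have Sconj i : conjugates S (f (artin_gen M i)).
  exists (f (artin_gen M i)); first by rewrite SE; exists i.
  by exists 1; rewrite mul1g invg1 mulg1.
pose s i : D := mk_dehn S0 (Sconj i).
have [pi pie] := env_to_group S0.
have piE w : pi (eval_word (e \o s) w) = f (pres_class (artin_rel M) w).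
  rewrite eval_word_morph morph_class; congr eval_word.
  by apply: funext => i /=; rewrite pie.
have [phi phiE] : exists phi : {multiplicative artin_group M -> Env D},
    forall i, phi (artin_gen M i) = e (s i).
  apply: (@pres_lift _ (artin_rel M) _ (e \o s)) => u v uv.
  have: pres_class (artin_rel M) u = pres_class (artin_rel M) v.
    by apply/pres_classP; exact: pres_rel.
  case: uv => i j [|m] ij Mij; first by have := artin_label_ge2 ij Mij.
  rewrite (alt_wordSl j i) alt_wordSr; set c := if odd m then j else i.
  rewrite -(cat1s (j, true)) !pres_class_cat !eval_word_cat !eval_word1 /=.
  move=> /(congr1 f) rel.
  (* [rel] says that the image of [(i j)_m] conjugates [s c] to [s j] in [A],
     which is what [env_conj] transports. *)
  suff -> : e (s j) = eval_word (e \o s) (alt_word i j m) * e (s c) *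
                      (eval_word (e \o s) (alt_word i j m))^-1.
    by rewrite mulgVK.
  apply: (env_conj pie); rewrite piE !mk_dehnK -gmulfM.
  by rewrite [f _ in RHS]rel gmulfM mulgK.
have piphi b : pi (phi b) = f b.
  rewrite -(pres_reprK b) -piE morph_class; congr (pi (eval_word _ _)).
  by apply: funext => i /=; rewrite -phiE.
(* Every generator is conjugate to some [e (s i)] by an element of the image
   of [phi], hence lies in that image. *)
have phi_surj : forall a, exists b, phi b = a.
  apply: pres_surj => x.
  have [t St [g xE]] := dehn_valP x.
  have [i _ tE] : range (fun i => f (artin_gen M i)) t by rewrite -SE.
  exists (k g * artin_gen M i * (k g)^-1).
  rewrite !gmulfM multiplicativeV phiE; apply/esym/(env_conj pie).
  by rewrite piphi kK mk_dehnK tE.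
exists pi, (phi \o k) => [a|x] /=; last by rewrite piphi kK.
by have [b <-] := phi_surj a; rewrite piphi fK.
Qed.
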